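(* Let $\Omega_+ := (0,\infty)\times(-1,1)\subset\mathbb{R}^2$ with coordinates $(x,y)$, and let $R := \sqrt{x^2+y^2}$. Consider the following Dirichlet problem with prescribed singular behavior for a real-valued function $u$: $$\partial_x\big((1+x^2)u_x\big)+\partial_y\big((1-y^2)u_y\big)=0\quad\text{in }\Omega_+,$$ $$u(0,y)=0\quad\text{for all } y \text{ with } 0<|y|<1,$$ $$u(x,1)=u(x,-1)=\frac{x}{1+x^2}\quad\text{for all }x>0,$$ $$u(x,y)=\frac1x+O_1(x^{-2})\quad\text{as }x\to\infty,$$ $$u(x,y)=\frac{x}{R^2}+o_1\!\left(\frac1R\right)\quad\text{as }R\to0.$$ If $u_1$ and $u_2$ are two solutions of this Dirichlet problem belonging to $C^2(\Omega_+)\cap C(\overline{\Omega_+}\setminus\{(0,0)\})$, then $u_1\equiv u_2$.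
   Context: The subscript $1$ in $O_1$ and $o_1$ means that upon differentiation the decay rate at infinity improves by one power and the blow-up rate at zero worsens by one power. Explicitly: a remainder $f$ is $O_1(x^{-2})$ as $x\to\infty$ if $f=O(x^{-2})$ and its first partial derivatives satisfy $f_x,f_y=O(x^{-3})$ as $x\to\infty$, uniformly in $y\in(-1,1)$; a remainder $f$ is $o_1(1/R)$ as $R\to0$ if $f=o(1/R)$ and $f_x,f_y=o(1/R^2)$ as $R\to 0$ within $\Omega_+$ (uniformly in direction). *)

(* Defs.v *)
From Stdlib Require Export Reals.
From Coquelicot Require Export Coquelicot.
Open Scope R_scope.

(** Functions of two real variables are total functions [R -> R -> R]; only
    their values on [punctured_closure] matter below. *)

Definition Omega_plus (p : R * R) : Prop := 0 < fst p /\ -1 < snd p < 1.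

(** The closure of [Omega_plus] with the origin removed. *)
Definition punctured_closure (p : R * R) : Prop :=
  0 <= fst p /\ -1 <= snd p <= 1 /\ p <> (0, 0).

Definition radius (x y : R) : R := sqrt (x ^ 2 + y ^ 2).

Definition partial_x (f : R -> R -> R) (x y : R) : R := Derive (fun t => f t y) x.
Definition partial_y (f : R -> R -> R) (x y : R) : R := Derive (fun t => f x t) y.

(** [ex_diff_n f 2] asks at each point for existence and continuity of all
    partial derivatives of order at most 2. *)
Definition C2_Omega_plus (u : R -> R -> R) : Prop :=
  forall x y : R, Omega_plus (x, y) -> ex_diff_n u 2 x y.

(** [f = O(x^{-k})] as [x -> +oo], uniformly in [y] in [(-1,1)]. *)
Definition bigO_infty (k : nat) (f : R -> R -> R) : Prop :=
  exists C : R, Rbar_locally p_infty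
    (fun x => forall y : R, -1 < y < 1 -> Rabs (f x y) <= C / x ^ k).

Definition bigO1_infty (k : nat) (f : R -> R -> R) : Prop :=
  bigO_infty k f /\
  bigO_infty (S k) (partial_x f) /\
  bigO_infty (S k) (partial_y f).

(** [f = o(1/R^k)] as [R -> 0] within [Omega_plus]. In Coquelicot,
    [is_domin F g f] reads [f = o(g)] along the filter [F]. *)
Definition littleo_origin (k : nat) (f : R -> R -> R) : Prop :=
  is_domin (within Omega_plus (locally (0, 0)))
    (fun p : R * R => 1 / radius (fst p) (snd p) ^ k)
    (fun p : R * R => f (fst p) (snd p)).

Definition littleo1_origin (k : nat) (f : R -> R -> R) : Prop :=
  littleo_origin k f /\
  littleo_origin (S k) (partial_x f) /\
  littleo_origin (S k) (partial_y f).

Record dirichlet_solution (u : R -> R -> R) : Prop := {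
  solution_pde : forall x y : R, Omega_plus (x, y) ->
    partial_x (fun s t => (1 + s ^ 2) * partial_x u s t) x y
    + partial_y (fun s t => (1 - t ^ 2) * partial_y u s t) x y = 0;
  solution_left : forall y : R, 0 < Rabs y < 1 -> u 0 y = 0;
  solution_top : forall x : R, 0 < x -> u x 1 = x / (1 + x ^ 2);
  solution_bottom : forall x : R, 0 < x -> u x (-1) = x / (1 + x ^ 2);
  solution_infty : bigO1_infty 2 (fun x y => u x y - 1 / x);
  solution_origin : littleo1_origin 1 (fun x y => u x y - x / radius x y ^ 2)
}.

(* Main.v *)
Require Import Defs.
From Stdlib Require Import ssreflect Lra List Classical ClassicalEpsilon.

(** The function [w = x / R^2] is the real part of [1 / (x + i y)]; it solves
    the equation and is positive in [Omega_plus].  For a difference [v] of two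
    solutions, integrating the gradient bound from the edge [x = 0], where [v]
    vanishes, improves [v = o(1/R)] to [v = o(w)] at the origin.  The maximum
    principle for [v - eps w + kappa x^2] on compact pieces [x <= M] of the
    punctured strip, with [kappa = eps / M^2] and [eps] tending to [0], gives
    [v <= 0]. *)

(** * Maxima on compact sets *)

(** Without a maximum, every point of the box has a neighbourhood on which [g], restricted to [D],
    stays below some value that [g] takes in [D]. Finitely many such neighbourhoods cover the box,
    and the largest of their values would lie below itself. *)
Lemma compact_attains_max (a b c d : R) (D : R * R -> Prop) (g : R * R -> R) :
  (forall p, D p -> a <= fst p <= b /\ c <= snd p <= d) ->
  closed D -> (exists p, D p) -> continuous_on D g ->
  exists p, D p /\ forall q, D q -> g q <= g p.
Proof.
intros bounded_D closed_D [p0 Dp0] cont_g.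
apply NNPP; intros no_max.
assert (larger : forall p, D p -> exists q, D q /\ g p < g q).
{ intros p Dp; apply NNPP; intros no_q; apply no_max.
  exists p; split; [exact Dp|]; intros q Dq.
  destruct (Rle_lt_dec (g q) (g p)) as [le|lt]; [exact le|].
  exfalso; apply no_q; exists q; split; assumption. }
assert (cover : forall t : Compactness.Tn 2 R, exists eq : posreal * (R * R),
  D (snd eq) /\ forall z1 z2, D (z1, z2) ->
    close_n 2 (fst eq) (z1, (z2, tt)) t -> g (z1, z2) < g (snd eq)).
{ intros [t1 [t2 []]].
  destruct (classic (D (t1, t2))) as [Dt|nDt].
  - destruct (larger _ Dt) as [q [Dq lt_q]].
    destruct (cont_g _ Dt _ (open_lt (g q) _ lt_q)) as [e near_t].
    exists (e, q); split; [exact Dq|]; simpl.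
    intros z1 z2 Dz [close1 [close2 _]].
    apply (near_t (z1, z2)); [split; assumption|exact Dz].
  - assert (away : locally (t1, t2) (fun z => ~ D z)).
    { apply NNPP; intros nl; exact (nDt (closed_D _ nl)). }
    destruct away as [e away].
    (* This neighbourhood misses [D], so the inequality is vacuous and [p0] is a placeholder. *)
    exists (e, p0); split; [exact Dp0|]; simpl.
    intros z1 z2 Dz [close1 [close2 _]].
    exfalso; apply (away (z1, z2)); [split; assumption|exact Dz]. }
set (pick t := proj1_sig (constructive_indefinite_description _ (cover t))).
assert (pickP : forall t, D (snd (pick t)) /\ forall z1 z2, D (z1, z2) ->
  close_n 2 (fst (pick t)) (z1, (z2, tt)) t -> g (z1, z2) < g (snd (pick t))).
{ intros t; unfold pick; apply proj2_sig. }
(* The finite list exists only under a double negation, which suffices because the goal is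
   [False]. *)
apply (compactness_list 2 (a, (c, tt)) (b, (d, tt)) (fun t => fst (pick t))).
intros [l cover_l].
assert (upper : exists q, D q /\ forall t, In t l -> g (snd (pick t)) <= g q).
{ clear cover_l; induction l as [|t l [q [Dq le_q]]].
  - exists p0; split; [exact Dp0|]; intros t [].
  - destruct (Rle_lt_dec (g (snd (pick t))) (g q)) as [le|lt].
    + exists q; split; [exact Dq|]; intros s [<-|in_s]; auto.
    + exists (snd (pick t)); split; [apply pickP|].
      intros s [<-|in_s]; [lra|]; specialize (le_q s in_s); lra. }
destruct upper as [[q1 q2] [Dq le_q]].
destruct (cover_l (q1, (q2, tt))) as [t [in_t [_ close_t]]].
{ destruct (bounded_D _ Dq); simpl in *; tauto. }
generalize (proj2 (pickP t) q1 q2 Dq close_t) (le_q t in_t); lra.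
Qed.

(** * Derivative tests at a local maximum *)

(** Near [x] the difference quotient is within [l / 2] of [l], hence positive. Only the derivative
    at [x] itself enters, so the second-derivative test can apply this to [h']. *)
Lemma positive_derivative_right (h : R -> R) (x l : R) :
  is_derive h x l -> 0 < l ->
  exists d : posreal, forall t, x < t < x + d -> h x < h t.
Proof.
intros dh l_gt0.
apply is_derive_Reals in dh.
destruct (dh (l / 2)) as [d near_x]; [lra|].
exists d; intros t lt_t.
specialize (near_x (t - x)).
assert (lt_l : Rabs ((h (x + (t - x)) - h x) / (t - x) - l) < l / 2).
{ apply near_x; [lra|]; rewrite Rabs_pos_eq; lra. }
replace (x + (t - x)) with t in lt_l by ring.
apply Rabs_def2 in lt_l.
assert (0 < (h t - h x) / (t - x) * (t - x)) by (apply Rmult_lt_0_compat; lra).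
replace ((h t - h x) / (t - x) * (t - x)) with (h t - h x) in H by (field; lra).
lra.
Qed.

Lemma positive_derivative_not_local_max (h : R -> R) (x l : R) :
  is_derive h x l -> 0 < l -> ~ locally x (fun t => h t <= h x).
Proof.
intros dh l_gt0 [e max_x].
destruct (positive_derivative_right _ _ _ dh l_gt0) as [d lt_x].
pose proof (cond_pos e) as e_gt0; pose proof (cond_pos d) as d_gt0.
set (s := Rmin e d / 2).
assert (s_gt0 : 0 < s).
{ unfold s; apply Rdiv_lt_0_compat; [apply Rmin_glb_lt; lra|lra]. }
assert (s_lt : s < e /\ s < d).
{ generalize (Rmin_l e d) (Rmin_r e d); unfold s in *; lra. }
assert (le_x : h (x + s) <= h x).
{ apply max_x; change (Rabs (x + s - x) < e); rewrite Rabs_pos_eq; lra. }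
specialize (lt_x (x + s)); lra.
Qed.

Lemma local_max_derivative (h : R -> R) (x l : R) :
  is_derive h x l -> locally x (fun t => h t <= h x) -> l = 0.
Proof.
intros dh max_x.
destruct (Rtotal_order l 0) as [lt|[eq|gt]]; [|exact eq|].
- exfalso.
  (* Reflecting [t] to [- t] reduces a negative derivative to the positive case. *)
  assert (dh' : is_derive (fun t => h (- t)) (- x) (- l)).
  { apply is_derive_Reals.
    replace (- l) with (l * -1) by ring.
    apply (derivable_pt_lim_comp Ropp h (- x) (-1) l).
    - apply is_derive_Reals; auto_derive; auto.
    - rewrite Ropp_involutive; apply is_derive_Reals, dh. }
  apply (positive_derivative_not_local_max _ _ _ dh'); [lra|].
  destruct max_x as [e max_x]; exists e; intros t near_t.
  rewrite Ropp_involutive; apply max_x.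
  change (Rabs (- t - x) < e); change (Rabs (t - - x) < e) in near_t.
  rewrite <- Rabs_Ropp; replace (- (- t - x)) with (t - - x) by ring.
  exact near_t.
- exfalso; exact (positive_derivative_not_local_max _ _ _ dh gt max_x).
Qed.

(** If [l] were positive, [h'], which vanishes at [x], would be positive just to the right of it,
    and by the mean value theorem [h] would exceed [h x] there. *)
Lemma local_max_second_derivative (h h' : R -> R) (x l : R) :
  locally x (fun t => is_derive h t (h' t)) -> is_derive h' x l ->
  locally x (fun t => h t <= h x) -> h' x = 0 /\ l <= 0.
Proof.
intros dh dh' max_x.
assert (crit : h' x = 0).
{ exact (local_max_derivative _ _ _ (locally_singleton _ _ dh) max_x). }
split; [exact crit|].
destruct (Rle_lt_dec l 0) as [le|l_gt0]; [exact le|exfalso].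
destruct (positive_derivative_right _ _ _ dh' l_gt0) as [d lt_x].
destruct (filter_and _ _ dh max_x) as [e near_x].
pose proof (cond_pos e) as e_gt0; pose proof (cond_pos d) as d_gt0.
set (s := Rmin e d / 2).
assert (s_gt0 : 0 < s).
{ unfold s; apply Rdiv_lt_0_compat; [apply Rmin_glb_lt; lra|lra]. }
assert (s_lt : s < e /\ s < d).
{ generalize (Rmin_l e d) (Rmin_r e d); unfold s in *; lra. }
assert (near : forall t, x <= t <= x + s -> is_derive h t (h' t) /\ h t <= h x).
{ intros t le_t; apply near_x; change (Rabs (t - x) < e).
  rewrite Rabs_pos_eq; lra. }
destruct (MVT_cor2 h h' x (x + s)) as [c [eq_c lt_c]]; [lra| |].
{ intros t le_t; apply is_derive_Reals, near, le_t. }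
assert (0 < h' c) by (rewrite <- crit; apply lt_x; lra).
assert (0 < h' c * (x + s - x)) by (apply Rmult_lt_0_compat; lra).
destruct (near (x + s)); lra.
Qed.

(** * The singular solution and its derivatives *)

(** The sum of squares stands for [radius x y ^ 2], so that differentiation meets no square root. *)
Definition dipole (x y : R) : R := x / (x ^ 2 + y ^ 2).

Lemma sum_sqr_pos (x y : R) : 0 < x -> 0 < x ^ 2 + y ^ 2.
Proof. intros x_gt0; nra. Qed.

Lemma is_derive_dipole_x (x y : R) : 0 < x ->
  is_derive (fun s => dipole s y) x ((y ^ 2 - x ^ 2) / (x ^ 2 + y ^ 2) ^ 2).
Proof.
intros x_gt0; generalize (sum_sqr_pos x y x_gt0); intros r_gt0.
unfold dipole; auto_derive; [lra|field; lra].
Qed.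

Lemma is_derive_dipole_xx (x y : R) : 0 < x ->
  is_derive (fun s => (y ^ 2 - s ^ 2) / (s ^ 2 + y ^ 2) ^ 2) x
    (2 * x * (x ^ 2 - 3 * y ^ 2) / (x ^ 2 + y ^ 2) ^ 3).
Proof.
intros x_gt0; generalize (sum_sqr_pos x y x_gt0); intros r_gt0.
auto_derive; [|field; lra].
apply Rgt_not_eq; exact (pow_lt _ 2 r_gt0).
Qed.

Lemma is_derive_dipole_y (x y : R) : 0 < x ->
  is_derive (fun t => dipole x t) y (- 2 * x * y / (x ^ 2 + y ^ 2) ^ 2).
Proof.
intros x_gt0; generalize (sum_sqr_pos x y x_gt0); intros r_gt0.
unfold dipole; auto_derive; [lra|field; lra].
Qed.

(** The value is the opposite of the second derivative in [x]: [dipole] is harmonic. *)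
Lemma is_derive_dipole_yy (x y : R) : 0 < x ->
  is_derive (fun t => - 2 * x * t / (x ^ 2 + t ^ 2) ^ 2) y
    (- (2 * x * (x ^ 2 - 3 * y ^ 2) / (x ^ 2 + y ^ 2) ^ 3)).
Proof.
intros x_gt0; generalize (sum_sqr_pos x y x_gt0); intros r_gt0.
auto_derive; [|field; lra].
apply Rgt_not_eq; exact (pow_lt _ 2 r_gt0).
Qed.

(** * Behaviour at the origin *)

(** Balls of the product space are squares, hence the box; halving the radius makes room for the
    weak inequalities. *)
Lemma littleo_origin_box (k : nat) (f : R -> R -> R) (eps : R) :
  littleo_origin k f -> 0 < eps ->
  exists d, 0 < d /\ forall x y, Omega_plus (x, y) -> x <= d -> Rabs y <= d ->
    Rabs (f x y) <= eps / radius x y ^ k.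
Proof.
intros small eps_gt0.
destruct (small (mkposreal eps eps_gt0)) as [d near_0].
pose proof (cond_pos d) as d_gt0.
exists (d / 2); split; [lra|].
intros x y Oxy le_x le_y.
assert (r_gt0 : 0 < radius x y ^ k).
{ apply pow_lt, sqrt_lt_R0, sum_sqr_pos, Oxy. }
assert (le : Rabs (f x y) <= eps * Rabs (1 / radius x y ^ k)).
{ apply (near_0 (x, y)); [|exact Oxy].
  destruct Oxy as [x_gt0 _]; simpl in x_gt0.
  split; [change (Rabs (x - 0) < d)|change (Rabs (y - 0) < d)];
    rewrite Rminus_0_r; [rewrite Rabs_pos_eq|]; lra. }
rewrite (Rabs_pos_eq (1 / _)) in le.
- replace (eps / radius x y ^ k) with (eps * (1 / radius x y ^ k))
    by (field; lra).
  exact le.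
- apply Rlt_le, Rdiv_lt_0_compat; lra.
Qed.

(** Since [y] is nonzero, the slice avoids the origin, and continuity within the closure applies
    down to [x = 0]. *)
Lemma continuous_on_slice_right (v : R -> R -> R) (y eps : R) :
  continuous_on punctured_closure (fun p : R * R => v (fst p) (snd p)) ->
  0 < Rabs y < 1 -> v 0 y = 0 -> 0 < eps ->
  exists d, 0 < d /\ forall x, 0 < x < d -> Rabs (v x y) < eps.
Proof.
intros cont_v [y_gt0 y_lt1] v0 eps_gt0.
assert (y_bound := Rabs_def2 _ _ y_lt1).
assert (Dy : forall x, 0 <= x -> punctured_closure (x, y)).
{ intros x x_ge0; repeat split; simpl; try lra.
  intros eq0; injection eq0; intros y0 _; subst y.
  rewrite Rabs_R0 in y_gt0; lra. }
destruct (proj1 (filterlim_locally _ _) (cont_v _ (Dy 0 (Rle_refl 0)))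
  (mkposreal eps eps_gt0)) as [d near_0].
exists d; split; [apply cond_pos|]; intros x lt_x.
assert (near : Rabs (v x y - v 0 y) < eps).
{ apply (near_0 (x, y)); [|apply Dy; lra].
  split; [|apply ball_center].
  change (Rabs (x - 0) < d); rewrite Rabs_pos_eq; lra. }
rewrite v0 Rminus_0_r in near; exact near.
Qed.

(** The bound on [v] itself suffices where [|y| <= x]; elsewhere one integrates
    the bound on [partial_x v] along the horizontal segment from [(0, y)], on
    which the distance to the origin stays comparable to [|y|]. *)
Lemma littleo_dipole (v : R -> R -> R) (eps : R) :
  continuous_on punctured_closure (fun p : R * R => v (fst p) (snd p)) ->
  (forall y, 0 < Rabs y < 1 -> v 0 y = 0) ->
  (forall x y, Omega_plus (x, y) -> ex_derive (fun s => v s y) x) ->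
  littleo_origin 1 v -> littleo_origin 2 (partial_x v) -> 0 < eps ->
  exists d, 0 < d /\ forall x y, Omega_plus (x, y) -> x <= d -> Rabs y <= d ->
    Rabs (v x y) <= eps * dipole x y.
Proof.
intros cont_v v0 dv small_v small_dv eps_gt0.
(* The factor 1/2 pays for [R <= 2 * x] where [Rabs y <= x], and for [R^2 <= 2 * y^2] elsewhere. *)
destruct (littleo_origin_box _ _ (eps / 2) small_v) as [d1 [d1_gt0 le_v]]; [lra|].
destruct (littleo_origin_box _ _ (eps / 2) small_dv) as [d2 [d2_gt0 le_dv]]; [lra|].
exists (Rmin d1 d2); split; [apply Rmin_glb_lt; assumption|].
intros x y Oxy le_x le_y.
assert (Oxy' := Oxy); destruct Oxy' as [x_gt0 y_bound]; simpl in x_gt0, y_bound.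
generalize (Rmin_l d1 d2) (Rmin_r d1 d2); intros le_d1 le_d2.
assert (sqr_radius : forall s, radius s y ^ 2 = s ^ 2 + y ^ 2).
{ intros s; unfold radius; apply pow2_sqrt; nra. }
assert (r2_gt0 := sum_sqr_pos x y x_gt0).
assert (sqr_y := pow2_abs y); assert (y_ge0 := Rabs_pos y).
assert (y_lt1 : Rabs y < 1) by (apply Rabs_def1; lra).
destruct (Rle_lt_dec (Rabs y) x) as [le_yx|lt_xy].
- assert (r_gt0 : 0 < radius x y) by (apply sqrt_lt_R0; exact r2_gt0).
  assert (r_le : radius x y <= 2 * x).
  { specialize (sqr_radius x).
    destruct (Rle_lt_dec (radius x y) (2 * x)); [assumption|exfalso; nra]. }
  specialize (le_v x y Oxy ltac:(lra) ltac:(lra)); rewrite pow_1 in le_v.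
  apply Rle_trans with (1 := le_v).
  unfold dipole; rewrite <- sqr_radius.
  apply Rmult_le_reg_r with (radius x y ^ 2); [rewrite sqr_radius; lra|].
  replace (eps / 2 / radius x y * radius x y ^ 2) with (eps / 2 * radius x y)
    by (field; lra).
  replace (eps * (x / radius x y ^ 2) * radius x y ^ 2) with (eps * x)
    by (field; lra).
  nra.
- assert (y2_gt0 : 0 < y ^ 2) by nra.
  assert (le_slope : forall s, 0 < s <= x ->
    Rabs (partial_x v s y) <= eps / 2 / y ^ 2).
  { intros s lt_s.
    assert (Os : Omega_plus (s, y)) by (split; simpl; lra).
    apply Rle_trans with (1 := le_dv s y Os ltac:(lra) ltac:(lra)).
    rewrite sqr_radius; apply Rmult_le_compat_l; [lra|].
    apply Rinv_le_contravar; [exact y2_gt0|nra]. }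
  apply Rle_trans with (eps / 2 / y ^ 2 * x).
  (* Differentiability is known only for positive abscissas, so the mean value theorem starts at a
     small [s > 0] where [v] is below [eta], and [eta] is arbitrary. *)
  + apply le_epsilon; intros eta eta_gt0.
    destruct (continuous_on_slice_right v y eta cont_v) as [d [d_gt0 lt_eta]];
      [lra|apply v0; lra|exact eta_gt0|].
    set (s := Rmin x d / 2).
    assert (s_gt0 : 0 < s).
    { unfold s; apply Rdiv_lt_0_compat; [apply Rmin_glb_lt; lra|lra]. }
    assert (s_lt : s < x /\ s < d).
    { generalize (Rmin_l x d) (Rmin_r x d); unfold s in *; lra. }
    destruct (MVT_cor2 (fun t => v t y) (fun t => partial_x v t y) s x)
      as [c [eq_c lt_c]]; [lra| |].
    { intros t le_t; apply is_derive_Reals, Derive_correct, dv.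
      split; simpl; lra. }
    specialize (lt_eta s ltac:(lra)); specialize (le_slope c ltac:(lra)).
    replace (v x y) with (partial_x v c y * (x - s) + v s y) by lra.
    apply Rle_trans with (1 := Rabs_triang _ _).
    rewrite Rabs_mult (Rabs_pos_eq (x - s)); [|lra].
    assert (0 <= Rabs (partial_x v c y)) by apply Rabs_pos.
    nra.
  + unfold dipole.
    replace (eps * (x / (x ^ 2 + y ^ 2))) with (eps * x / (x ^ 2 + y ^ 2))
      by (field; lra).
    replace (eps / 2 / y ^ 2 * x) with (eps * x / (2 * y ^ 2))
      by (field; intros y0; subst y; lra).
    apply Rmult_le_compat_l; [nra|].
    apply Rinv_le_contravar; nra.
Qed.

(** * Truncated strips and continuity on them *)

Lemma locally_between (a b x : R) : a < x < b -> locally x (fun t => a < t < b).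
Proof.
intros [lt_ax lt_xb].
apply: (filter_and _ _ (open_gt a x lt_ax) (open_lt b x lt_xb)).
Qed.

Lemma continuous_sum_sqr (p : R * R) :
  continuous (fun q : R * R => fst q ^ 2 + snd q ^ 2) p.
Proof.
apply: continuous_plus.
- apply (continuous_comp fst (fun s => s ^ 2)); [apply continuous_fst|].
  apply: ex_derive_continuous; auto_derive; auto.
- apply (continuous_comp snd (fun s => s ^ 2)); [apply continuous_snd|].
  apply: ex_derive_continuous; auto_derive; auto.
Qed.

(** For [d > 0], this is a compact set on which [dipole] is continuous; squaring the distance keeps
    the condition polynomial. *)
Definition truncation (d M : R) (p : R * R) : Prop :=
  0 <= fst p <= M /\ -1 <= snd p <= 1 /\ d ^ 2 <= fst p ^ 2 + snd p ^ 2.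

Lemma closed_truncation (d M : R) : closed (truncation d M).
Proof.
unfold truncation.
apply closed_and; [apply closed_and|apply closed_and; [apply closed_and|]].
- apply (closed_comp fst (fun s => 0 <= s)); [intros; apply continuous_fst|].
  apply closed_ge.
- apply (closed_comp fst (fun s => s <= M)); [intros; apply continuous_fst|].
  apply closed_le.
- apply (closed_comp snd (fun s => -1 <= s)); [intros; apply continuous_snd|].
  apply closed_ge.
- apply (closed_comp snd (fun s => s <= 1)); [intros; apply continuous_snd|].
  apply closed_le.
- apply (closed_comp (fun q : R * R => fst q ^ 2 + snd q ^ 2) (fun s => d ^ 2 <= s)).
  + intros; apply continuous_sum_sqr.
  + apply closed_ge.
Qed.

Lemma continuous_perturbation (v : R -> R -> R) (eps kappa : R) (D : R * R -> Prop) :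
  (forall p, D p -> punctured_closure p /\ 0 < fst p ^ 2 + snd p ^ 2) ->
  continuous_on punctured_closure (fun p : R * R => v (fst p) (snd p)) ->
  continuous_on D (fun p : R * R =>
    v (fst p) (snd p) - eps * dipole (fst p) (snd p) + kappa * fst p ^ 2).
Proof.
intros sub cont_v.
(* The sum is regrouped because [v] is continuous only relative to the domain, while the other terms
   are continuous on full neighbourhoods. *)
apply continuous_on_ext with (fun p : R * R => plus (v (fst p) (snd p))
  (- eps * dipole (fst p) (snd p) + kappa * fst p ^ 2)).
{ intros q _; unfold plus; simpl; ring. }
intros p Dp; destruct (sub p Dp) as [_ r_gt0].
assert (cont_rest : continuous (fun p : R * R =>
  - eps * dipole (fst p) (snd p) + kappa * fst p ^ 2) p).
{ apply: continuous_plus.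
  - apply: continuous_scal; [apply continuous_const|].
    apply: continuous_mult; [apply continuous_fst|].
    apply (continuous_comp (fun q : R * R => fst q ^ 2 + snd q ^ 2) Rinv).
    + apply continuous_sum_sqr.
    + apply: ex_derive_continuous; auto_derive; lra.
  - apply (continuous_comp fst (fun s => kappa * s ^ 2)); [apply continuous_fst|].
    apply: ex_derive_continuous; auto_derive; auto. }
apply: filterlim_comp_2; [| |apply: filterlim_plus].
- exact (continuous_on_subset _ _ _ (fun q Dq => proj1 (sub q Dq)) cont_v p Dp).
- intros P near; destruct (cont_rest P near) as [e P_near].
  exists e; intros q near_q _; exact (P_near q near_q).
Qed.

(** * The maximum principle *)

(** The equation with its products expanded, together with the differentiability that it uses. Being
    linear and homogeneous, the condition passes to differences. *)
Definition elliptic_solution (v : R -> R -> R) : Prop :=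
  forall x y, Omega_plus (x, y) ->
    ex_derive (fun s => v s y) x /\ ex_derive (fun t => v x t) y /\
    ex_derive (fun s => partial_x v s y) x /\
    ex_derive (fun t => partial_y v x t) y /\
    (1 + x ^ 2) * partial_x (partial_x v) x y + 2 * x * partial_x v x y
    + ((1 - y ^ 2) * partial_y (partial_y v) x y - 2 * y * partial_y v x y) = 0.

(** The operator maps [x ^ 2] to [2 + 6 x ^ 2 > 0] and annihilates both [v] and
    [dipole], so the perturbed function is a strict subsolution. *)
Lemma perturbation_no_interior_max (v : R -> R -> R) (eps kappa x y : R)
  (g := fun s t => v s t - eps * dipole s t + kappa * s ^ 2) :
  elliptic_solution v -> 0 < kappa -> Omega_plus (x, y) ->
  locally x (fun s => g s y <= g x y) -> locally y (fun t => g x t <= g x y) ->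
  False.
Proof.
intros sol_v kappa_gt0 Oxy max_x max_y.
assert (Oxy' := Oxy); destruct Oxy' as [x_gt0 y_bound]; simpl in x_gt0, y_bound.
destruct (sol_v x y Oxy) as (_ & _ & dvxx & dvyy & pde).
assert (r2_gt0 := sum_sqr_pos x y x_gt0).
destruct (local_max_second_derivative (fun s => g s y)
  (fun s => partial_x v s y - eps * ((y ^ 2 - s ^ 2) / (s ^ 2 + y ^ 2) ^ 2)
            + kappa * (2 * s)) x
  (partial_x (partial_x v) x y
   - eps * (2 * x * (x ^ 2 - 3 * y ^ 2) / (x ^ 2 + y ^ 2) ^ 3) + kappa * 2))
  as [gx gxx]; [| |exact max_x|].
{ apply: filter_imp (open_gt 0 x x_gt0); intros s s_gt0.
  unfold g; apply: is_derive_plus; [apply: is_derive_minus|].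
  - assert (Os : Omega_plus (s, y)) by (split; simpl; lra).
    exact (Derive_correct _ _ (proj1 (sol_v s y Os))).
  - apply: is_derive_scal; apply is_derive_dipole_x, s_gt0.
  - auto_derive; [auto|ring]. }
{ apply: is_derive_plus; [apply: is_derive_minus|].
  - exact (Derive_correct _ _ dvxx).
  - apply: is_derive_scal; apply is_derive_dipole_xx, x_gt0.
  - auto_derive; [auto|ring]. }
destruct (local_max_second_derivative (fun t => g x t)
  (fun t => partial_y v x t - eps * (- 2 * x * t / (x ^ 2 + t ^ 2) ^ 2)) y
  (partial_y (partial_y v) x y
   - eps * (- (2 * x * (x ^ 2 - 3 * y ^ 2) / (x ^ 2 + y ^ 2) ^ 3))))
  as [gy gyy]; [| |exact max_y|].
{ apply: filter_imp (locally_between (-1) 1 y y_bound); intros t lt_t.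
  (* The term [kappa * x ^ 2] is constant in [t]; the added 0 is its derivative. *)
  unfold g; rewrite <- (Rplus_0_r (_ - _)).
  apply: is_derive_plus; [apply: is_derive_minus|].
  - assert (Ot : Omega_plus (x, t)) by (split; simpl; lra).
    exact (Derive_correct _ _ (proj1 (proj2 (sol_v x t Ot)))).
  - apply: is_derive_scal; apply is_derive_dipole_y, x_gt0.
  - auto_derive; [auto|ring]. }
{ apply: is_derive_minus.
  - exact (Derive_correct _ _ dvyy).
  - apply: is_derive_scal; apply is_derive_dipole_yy, x_gt0. }
set (wx := (y ^ 2 - x ^ 2) / (x ^ 2 + y ^ 2) ^ 2) in *.
set (wy := - 2 * x * y / (x ^ 2 + y ^ 2) ^ 2) in *.
set (wxx := 2 * x * (x ^ 2 - 3 * y ^ 2) / (x ^ 2 + y ^ 2) ^ 3) in *.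
assert (pde_w : (1 + x ^ 2) * wxx + 2 * x * wx + ((1 - y ^ 2) * - wxx - 2 * y * wy) = 0).
{ unfold wx, wy, wxx; field; lra. }
assert (a_gt0 : 0 < 1 + x ^ 2) by nra.
assert (b_gt0 : 0 < 1 - y ^ 2) by nra.
(* The first derivatives of [g] vanish at the maximum, which determines those of [v]. *)
replace (partial_x v x y) with (eps * wx - kappa * (2 * x)) in pde by lra.
replace (partial_y v x y) with (eps * wy) in pde by lra.
set (vxx := partial_x (partial_x v) x y) in *.
set (vyy := partial_y (partial_y v) x y) in *.
assert (exx : (1 + x ^ 2) * (vxx - eps * wxx + kappa * 2) <= 0) by nra.
assert (eyy : (1 - y ^ 2) * (vyy - eps * - wxx) <= 0) by nra.
assert (pde_eps : eps * ((1 + x ^ 2) * wxx + 2 * x * wx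
  + ((1 - y ^ 2) * - wxx - 2 * y * wy)) = 0) by (rewrite pde_w; ring).
(* By [pde] and [pde_eps], the left sides of [exx] and [eyy] add up to this positive quantity. *)
assert (0 < kappa * (2 + 6 * x ^ 2)) by (apply Rmult_lt_0_compat; nra).
nra.
Qed.

(** The maximum of the perturbed function over a truncation cannot be interior, and on each part of
    the boundary [v <= eps + eps * dipole]. Since [kappa * s ^ 2 <= eps] there, the maximum is at
    most [2 * eps]. *)
Lemma elliptic_solution_nonpositive (v : R -> R -> R) :
  elliptic_solution v ->
  continuous_on punctured_closure (fun p : R * R => v (fst p) (snd p)) ->
  (forall x y, punctured_closure (x, y) -> x = 0 \/ y = 1 \/ y = -1 -> v x y = 0) ->
  (forall eps, 0 < eps -> exists d, 0 < d /\
    forall x y, Omega_plus (x, y) -> x <= d -> Rabs y <= d ->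
      v x y <= eps * dipole x y) ->
  (forall eps, 0 < eps -> exists M,
    forall x y, Omega_plus (x, y) -> M <= x -> v x y <= eps) ->
  forall x y, Omega_plus (x, y) -> v x y <= 0.
Proof.
intros sol_v cont_v v_edge v_origin v_infty x y Oxy.
assert (Oxy' := Oxy); destruct Oxy' as [x_gt0 y_bound]; simpl in x_gt0, y_bound.
assert (w_ge0 : forall s t, 0 <= s -> 0 < s ^ 2 + t ^ 2 -> 0 <= dipole s t).
{ intros s t s_ge0 r2_gt0; apply Rmult_le_pos; [exact s_ge0|].
  apply Rlt_le, Rinv_0_lt_compat, r2_gt0. }
assert (w_xy := w_ge0 x y ltac:(lra) (sum_sqr_pos x y x_gt0)).
apply le_epsilon; intros eta eta_gt0; rewrite Rplus_0_l.
(* The final estimate is [v x y <= eps * (dipole x y + 2)], which this choice makes equal to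
   [eta]. *)
set (eps := eta / (dipole x y + 2)).
assert (eps_gt0 : 0 < eps) by (apply Rdiv_lt_0_compat; lra).
replace eta with (eps * (dipole x y + 2)) by (unfold eps; field; lra).
destruct (v_origin eps eps_gt0) as [d0 [d0_gt0 le_origin]].
destruct (v_infty eps eps_gt0) as [M0 le_infty].
(* Comparing with [x] ensures that [(x, y)] itself lies in the truncation. *)
set (d := Rmin d0 x); set (M := Rmax M0 x).
assert (d_gt0 : 0 < d) by (apply Rmin_glb_lt; assumption).
assert (le_d : d <= d0 /\ d <= x) by (split; [apply Rmin_l|apply Rmin_r]).
assert (le_M : M0 <= M /\ x <= M) by (split; [apply Rmax_l|apply Rmax_r]).
assert (M2_gt0 : 0 < M ^ 2) by nra.
set (kappa := eps / M ^ 2).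
assert (kappa_gt0 : 0 < kappa) by (apply Rdiv_lt_0_compat; assumption).
assert (kappaM : kappa * M ^ 2 = eps) by (unfold kappa; field; nra).
set (g := fun s t => v s t - eps * dipole s t + kappa * s ^ 2).
assert (sub : forall p, truncation d M p ->
  punctured_closure p /\ 0 < fst p ^ 2 + snd p ^ 2).
{ intros [s t] (s_bound & t_bound & le_r2); simpl fst in *; simpl snd in *.
  assert (r2_gt0 : 0 < s ^ 2 + t ^ 2) by nra.
  repeat split; try (simpl; lra).
  intros eq0; injection eq0; intros; subst; lra. }
destruct (compact_attains_max 0 M (-1) 1 (truncation d M)
  (fun p => g (fst p) (snd p))) as [[s t] [Dst max_st]].
{ intros p (s_bound & t_bound & _); split; assumption. }
{ apply closed_truncation. }
{ exists (x, y); unfold truncation; simpl fst; simpl snd.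
  repeat split; try lra; nra. }
{ apply continuous_perturbation; assumption. }
assert (g_st : g s t <= eps + eps).
{ destruct (sub _ Dst) as [Cst r2_gt0]; simpl in r2_gt0.
  destruct Dst as (s_bound & t_bound & le_r2); simpl fst in *; simpl snd in *.
  assert (v_le : v s t <= eps + eps * dipole s t).
  { assert (w_st := w_ge0 s t ltac:(lra) ltac:(simpl; lra)).
    assert (epsw_ge0 : 0 <= eps * dipole s t) by nra.
    destruct (classic (s = 0 \/ t = 1 \/ t = -1)) as [edge|not_edge].
    { rewrite (v_edge s t Cst edge); lra. }
    assert (Ost : Omega_plus (s, t)).
    { destruct (Req_dec s 0), (Req_dec t 1), (Req_dec t (-1)); try tauto.
      split; simpl; lra. }
    destruct (Rle_lt_dec M s) as [le_Ms|lt_sM].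
    { generalize (le_infty s t Ost ltac:(lra)); lra. }
    (* On the arc both coordinates are at most [d] in absolute value, so the estimate in the box at
       the origin applies. *)
    destruct (Rle_lt_dec (s ^ 2 + t ^ 2) (d ^ 2)) as [le_d2|lt_d2].
    { assert (s <= d0) by nra.
      assert (Rabs t <= d0) by (apply Rabs_le; split; nra).
      generalize (le_origin s t Ost ltac:(lra) ltac:(lra)); lra. }
    exfalso; destruct Ost as [s_gt0 t_lt1]; simpl in s_gt0, t_lt1.
    apply (perturbation_no_interior_max v eps kappa s t); auto.
    { split; assumption. }
    (* All constraints are strict at [(s, t)] and persist nearby, so the maximum over the truncation
       is a local maximum along each axis. *)
    - assert (far : locally s (fun s' => d ^ 2 < s' ^ 2 + t ^ 2)).
      { assert (cont : continuous (fun s' => s' ^ 2 + t ^ 2) s).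
        { apply: ex_derive_continuous; auto_derive; auto. }
        exact (cont _ (open_gt _ _ lt_d2)). }
      apply: filter_imp (filter_and _ _ far
        (locally_between 0 M s (conj s_gt0 lt_sM))).
      intros s' [far' s'_bound]; apply (max_st (s', t)).
      unfold truncation; simpl fst; simpl snd; repeat split; lra.
    - assert (far : locally t (fun t' => d ^ 2 < s ^ 2 + t' ^ 2)).
      { assert (cont : continuous (fun t' => s ^ 2 + t' ^ 2) t).
        { apply: ex_derive_continuous; auto_derive; auto. }
        exact (cont _ (open_gt _ _ lt_d2)). }
      apply: filter_imp (filter_and _ _ far (locally_between (-1) 1 t t_lt1)).
      intros t' [far' t'_bound]; apply (max_st (s, t')).
      unfold truncation; simpl fst; simpl snd; repeat split; lra. }
  assert (kappa * s ^ 2 <= eps).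
  { rewrite <- kappaM; apply Rmult_le_compat_l; [lra|nra]. }
  unfold g; lra. }
assert (g_xy : g x y <= g s t).
{ apply (max_st (x, y)); unfold truncation; simpl fst; simpl snd.
  repeat split; try lra; nra. }
assert (0 <= kappa * x ^ 2) by nra.
unfold g in *; lra.
Qed.

(** * Differences of solutions *)

(** The boundary data omit the corners [(0, 1)] and [(0, -1)]; there the value follows by continuity
    along the horizontal edges. *)
Lemma punctured_edge_zero (v : R -> R -> R) :
  continuous_on punctured_closure (fun p : R * R => v (fst p) (snd p)) ->
  (forall y, 0 < Rabs y < 1 -> v 0 y = 0) ->
  (forall x, 0 < x -> v x 1 = 0) -> (forall x, 0 < x -> v x (-1) = 0) ->
  forall x y, punctured_closure (x, y) -> x = 0 \/ y = 1 \/ y = -1 -> v x y = 0.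
Proof.
intros cont_v v_left v_top v_bottom.
assert (corner : forall y, y = 1 \/ y = -1 ->
  (forall x, 0 < x -> v x y = 0) -> v 0 y = 0).
{ intros y y_eq v_y.
  assert (Cy : forall x, 0 <= x -> punctured_closure (x, y)).
  { intros x x_ge0; repeat split; simpl; try (destruct y_eq; lra).
    intros eq0; injection eq0; intros; destruct y_eq; lra. }
  apply cond_eq; intros eps eps_gt0.
  destruct (proj1 (filterlim_locally _ _) (cont_v _ (Cy 0 (Rle_refl 0)))
    (mkposreal eps eps_gt0)) as [d near_0].
  pose proof (cond_pos d) as d_gt0.
  assert (near : Rabs (v (d / 2) y - v 0 y) < eps).
  { apply (near_0 (d / 2, y)); [|apply Cy; lra].
    split; [|apply ball_center].
    change (Rabs (d / 2 - 0) < d); rewrite Rabs_pos_eq; lra. }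
  rewrite (v_y (d / 2)) in near; [|lra].
  rewrite Rabs_minus_sym; exact near. }
intros x y (x_ge0 & y_bound & not_0) edge; simpl in x_ge0, y_bound.
destruct (Req_dec y 1) as [->|y_neq1].
{ destruct (Req_dec x 0) as [->|]; [apply corner; auto|apply v_top; lra]. }
destruct (Req_dec y (-1)) as [->|y_neqN1].
{ destruct (Req_dec x 0) as [->|]; [apply corner; auto|apply v_bottom; lra]. }
destruct edge as [->|[|]]; [|tauto|tauto].
apply v_left; split.
- apply Rabs_pos_lt; intros ->; apply not_0; reflexivity.
- apply Rabs_def1; lra.
Qed.

(** Asking for the identity only in [Omega_plus] allows [h] to be a partial derivative of a
    difference, which splits there. *)
Lemma littleo_origin_minus (k : nat) (f g h : R -> R -> R) :
  (forall x y, Omega_plus (x, y) -> h x y = f x y - g x y) ->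
  littleo_origin k f -> littleo_origin k g -> littleo_origin k h.
Proof.
intros eq_h small_f small_g [eps eps_gt0].
assert (half : 0 < eps / 2) by lra.
destruct (filter_and _ _ (small_f (mkposreal _ half))
  (small_g (mkposreal _ half))) as [d near_0].
exists d; intros [x y] near_xy Oxy.
destruct (near_0 _ near_xy Oxy) as [le_f le_g].
change (Rabs (f x y) <= eps / 2 * Rabs (1 / radius x y ^ k)) in le_f.
change (Rabs (g x y) <= eps / 2 * Rabs (1 / radius x y ^ k)) in le_g.
change (Rabs (h x y) <= eps * Rabs (1 / radius x y ^ k)).
rewrite (eq_h x y Oxy); unfold Rminus.
apply Rle_trans with (1 := Rabs_triang _ _); rewrite Rabs_Ropp; lra.
Qed.

Lemma dirichlet_elliptic_solution (u : R -> R -> R) :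
  C2_Omega_plus u -> dirichlet_solution u -> elliptic_solution u.
Proof.
intros C2_u sol_u x y Oxy.
(* From the nested conditions of order 2, the pattern keeps both first derivatives and the two pure
   second ones. *)
destruct (C2_u x y Oxy)
  as (_ & dux & duy & (_ & duxx & _) & (_ & _ & duyy & _)).
repeat split; try assumption.
rewrite <- (solution_pde u sol_u x y Oxy).
f_equal; symmetry; apply is_derive_unique.
- replace ((1 + x ^ 2) * partial_x (partial_x u) x y + 2 * x * partial_x u x y)
    with (2 * x * partial_x u x y + (1 + x ^ 2) * partial_x (partial_x u) x y)
    by ring.
  apply (is_derive_mult (fun s => 1 + s ^ 2) (fun s => partial_x u s y)).
  + auto_derive; [auto|ring].
  + exact (Derive_correct _ _ duxx).
  + exact Rmult_comm.
- replace ((1 - y ^ 2) * partial_y (partial_y u) x y - 2 * y * partial_y u x y)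
    with (- 2 * y * partial_y u x y + (1 - y ^ 2) * partial_y (partial_y u) x y)
    by ring.
  apply (is_derive_mult (fun t => 1 - t ^ 2) (fun t => partial_y u x t)).
  + auto_derive; [auto|ring].
  + exact (Derive_correct _ _ duyy).
  + exact Rmult_comm.
Qed.

Lemma elliptic_solution_minus (u1 u2 : R -> R -> R) :
  elliptic_solution u1 -> elliptic_solution u2 ->
  elliptic_solution (fun x y => u1 x y - u2 x y).
Proof.
intros sol_u1 sol_u2 x y Oxy.
assert (px : forall s t, Omega_plus (s, t) ->
  partial_x (fun x y => u1 x y - u2 x y) s t = partial_x u1 s t - partial_x u2 s t).
{ intros s t Ost; apply Derive_minus; [apply (sol_u1 s t Ost)|apply (sol_u2 s t Ost)]. }
assert (py : forall s t, Omega_plus (s, t) ->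
  partial_y (fun x y => u1 x y - u2 x y) s t = partial_y u1 s t - partial_y u2 s t).
{ intros s t Ost; apply Derive_minus; [apply (sol_u1 s t Ost)|apply (sol_u2 s t Ost)]. }
destruct (sol_u1 x y Oxy) as (dx1 & dy1 & dxx1 & dyy1 & pde1).
destruct (sol_u2 x y Oxy) as (dx2 & dy2 & dxx2 & dyy2 & pde2).
assert (Oxy' := Oxy); destruct Oxy' as [x_gt0 y_bound]; simpl in x_gt0, y_bound.
(* A second derivative depends on the first one near the point, so the splitting is needed on a
   neighbourhood. *)
assert (loc_x : locally x (fun s => partial_x u1 s y - partial_x u2 s y
  = partial_x (fun x y => u1 x y - u2 x y) s y)).
{ destruct (open_gt 0 x x_gt0) as [e pos_e]; exists e; intros s near_s.
  symmetry; apply px; split; [exact (pos_e s near_s)|exact y_bound]. }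
assert (loc_y : locally y (fun t => partial_y u1 x t - partial_y u2 x t
  = partial_y (fun x y => u1 x y - u2 x y) x t)).
{ destruct (locally_between (-1) 1 y y_bound) as [e bound_e].
  exists e; intros t near_t.
  symmetry; apply py; split; [exact x_gt0|exact (bound_e t near_t)]. }
assert (pxx : partial_x (partial_x (fun x y => u1 x y - u2 x y)) x y
  = partial_x (partial_x u1) x y - partial_x (partial_x u2) x y).
{ transitivity (Derive (fun s => partial_x u1 s y - partial_x u2 s y) x).
  - symmetry; exact (Derive_ext_loc _ _ _ loc_x).
  - apply Derive_minus; assumption. }
assert (pyy : partial_y (partial_y (fun x y => u1 x y - u2 x y)) x y
  = partial_y (partial_y u1) x y - partial_y (partial_y u2) x y).
{ transitivity (Derive (fun t => partial_y u1 x t - partial_y u2 x t) y).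
  - symmetry; exact (Derive_ext_loc _ _ _ loc_y).
  - apply Derive_minus; assumption. }
split; [exact (ex_derive_minus _ _ _ dx1 dx2)|].
split; [exact (ex_derive_minus _ _ _ dy1 dy2)|].
split; [exact (ex_derive_ext_loc _ _ _ loc_x (ex_derive_minus _ _ _ dxx1 dxx2))|].
split; [exact (ex_derive_ext_loc _ _ _ loc_y (ex_derive_minus _ _ _ dyy1 dyy2))|].
rewrite pxx pyy px ?py; [|exact Oxy|exact Oxy]; lra.
Qed.

(** Isolates the derivative of the prescribed singular part, which then cancels between two
    solutions. *)
Lemma partial_x_minus_regularized (u : R -> R -> R) (x y : R) :
  0 < x -> ex_derive (fun s => u s y) x ->
  partial_x (fun s t => u s t - s / radius s t ^ 2) x y
  = partial_x u x y - partial_x dipole x y.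
Proof.
intros x_gt0 du.
assert (eq_loc : forall s, u s y - dipole s y = u s y - s / radius s y ^ 2).
{ intros s; unfold dipole, radius; rewrite pow2_sqrt; [reflexivity|nra]. }
transitivity (Derive (fun s => u s y - dipole s y) x).
{ symmetry; exact (Derive_ext _ _ _ eq_loc). }
apply Derive_minus; [exact du|].
exists ((y ^ 2 - x ^ 2) / (x ^ 2 + y ^ 2) ^ 2); apply is_derive_dipole_x, x_gt0.
Qed.

(** The hypotheses are symmetric in the two solutions, so this one-sided comparison gives uniqueness
    by exchanging them. *)
Lemma dirichlet_solution_le (u1 u2 : R -> R -> R) :
  C2_Omega_plus u1 ->
  continuous_on punctured_closure (fun p : R * R => u1 (fst p) (snd p)) ->
  dirichlet_solution u1 ->
  C2_Omega_plus u2 ->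
  continuous_on punctured_closure (fun p : R * R => u2 (fst p) (snd p)) ->
  dirichlet_solution u2 ->
  forall x y, punctured_closure (x, y) -> u1 x y <= u2 x y.
Proof.
intros C2_u1 C0_u1 sol_u1 C2_u2 C0_u2 sol_u2.
assert (ell_u1 := dirichlet_elliptic_solution _ C2_u1 sol_u1).
assert (ell_u2 := dirichlet_elliptic_solution _ C2_u2 sol_u2).
set (v := fun x y => u1 x y - u2 x y).
assert (ell_v : elliptic_solution v) by (apply elliptic_solution_minus; assumption).
assert (cont_v : continuous_on punctured_closure (fun p : R * R => v (fst p) (snd p))).
{ intros p Cp; unfold v, Rminus.
  apply: filterlim_comp_2; [exact (C0_u1 p Cp)| |apply: filterlim_plus].
  apply: filterlim_comp; [exact (C0_u2 p Cp)|apply: filterlim_opp]. }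
assert (v_left : forall y, 0 < Rabs y < 1 -> v 0 y = 0).
{ intros y y_bound; unfold v.
  rewrite (solution_left _ sol_u1 y y_bound) (solution_left _ sol_u2 y y_bound); ring. }
assert (v_edge : forall x y, punctured_closure (x, y) ->
  x = 0 \/ y = 1 \/ y = -1 -> v x y = 0).
{ apply (punctured_edge_zero v cont_v v_left); intros x x_gt0; unfold v.
  - rewrite (solution_top _ sol_u1 x x_gt0) (solution_top _ sol_u2 x x_gt0); ring.
  - rewrite (solution_bottom _ sol_u1 x x_gt0) (solution_bottom _ sol_u2 x x_gt0); ring. }
assert (v_neg : forall x y, Omega_plus (x, y) -> v x y <= 0).
{ apply elliptic_solution_nonpositive; try assumption.
  - intros eps eps_gt0.
    destruct (solution_origin _ sol_u1) as (small1 & small_x1 & _).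
    destruct (solution_origin _ sol_u2) as (small2 & small_x2 & _).
    destruct (littleo_dipole v eps) as [d [d_gt0 le_d]]; try assumption.
    + intros x y Oxy; apply (ell_v x y Oxy).
    + apply littleo_origin_minus with (2 := small1) (3 := small2).
      intros x y _; unfold v; ring.
    + apply littleo_origin_minus with (2 := small_x1) (3 := small_x2).
      intros x y Oxy; destruct (ell_u1 x y Oxy) as [du1 _].
      destruct (ell_u2 x y Oxy) as [du2 _].
      assert (x_gt0 := proj1 Oxy); simpl in x_gt0.
      rewrite !partial_x_minus_regularized; try assumption.
      unfold partial_x, v; rewrite Derive_minus; [ring|exact du1|exact du2].
    + exists d; split; [exact d_gt0|]; intros x y Oxy le_x le_y.
      apply Rle_trans with (1 := Rle_abs _); auto.
  - intros eps eps_gt0.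
    destruct (solution_infty _ sol_u1) as ([C1 [M1 bound1]] & _).
    destruct (solution_infty _ sol_u2) as ([C2 [M2 bound2]] & _).
    set (C := Rabs C1 + Rabs C2).
    assert (C_ge0 : 0 <= C) by (unfold C; generalize (Rabs_pos C1) (Rabs_pos C2); lra).
    (* For [x >= M], the bound 1 gives [x <= x ^ 2], the bound [C / eps] then gives
       [C / x ^ 2 <= eps], and the added 1 yields the strict inequalities [M1 < x] and [M2 < x] that
       the filter at infinity requires. *)
    set (M := Rmax 1 (Rmax (C / eps) (Rmax M1 M2 + 1))).
    assert (le_M : 1 <= M /\ C / eps <= M /\ M1 < M /\ M2 < M).
    { unfold M; generalize (Rmax_l 1 (Rmax (C / eps) (Rmax M1 M2 + 1)))
        (Rmax_r 1 (Rmax (C / eps) (Rmax M1 M2 + 1)))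
        (Rmax_l (C / eps) (Rmax M1 M2 + 1)) (Rmax_r (C / eps) (Rmax M1 M2 + 1))
        (Rmax_l M1 M2) (Rmax_r M1 M2).
      intros; repeat split; lra. }
    exists M; intros x y [_ y_bound] le_x; simpl in y_bound.
    specialize (bound1 x ltac:(lra) y y_bound).
    specialize (bound2 x ltac:(lra) y y_bound).
    apply Rabs_le_between in bound1; apply Rabs_le_between in bound2.
    assert (le_C : C / x ^ 2 <= eps).
    { apply Rmult_le_reg_r with (x ^ 2); [nra|].
      replace (C / x ^ 2 * x ^ 2) with C by (field; lra).
      replace C with (eps * (C / eps)) by (field; lra).
      apply Rmult_le_compat_l; [lra|nra]. }
    assert (C1 / x ^ 2 + C2 / x ^ 2 <= C / x ^ 2).
    { rewrite <- Rdiv_plus_distr; apply Rmult_le_compat_r.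
      - apply Rlt_le, Rinv_0_lt_compat; nra.
      - unfold C; generalize (Rle_abs C1) (Rle_abs C2); lra. }
    unfold v; lra. }
intros x y Cxy.
assert (v x y <= 0); [|unfold v in *; lra].
destruct (classic (x = 0 \/ y = 1 \/ y = -1)) as [edge|not_edge].
- rewrite (v_edge x y Cxy edge); lra.
- apply v_neg; destruct Cxy as (x_ge0 & y_bound & _); simpl in x_ge0, y_bound.
  destruct (Req_dec x 0), (Req_dec y 1), (Req_dec y (-1)); try tauto.
  split; simpl; lra.
Qed.

Theorem theorem4p1 (u1 u2 : R -> R -> R)
  (C2_u1 : C2_Omega_plus u1)
  (C0_u1 : continuous_on punctured_closure (fun p : R * R => u1 (fst p) (snd p)))
  (sol_u1 : dirichlet_solution u1)
  (C2_u2 : C2_Omega_plus u2)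
  (C0_u2 : continuous_on punctured_closure (fun p : R * R => u2 (fst p) (snd p)))
  (sol_u2 : dirichlet_solution u2) :
  forall x y : R, punctured_closure (x, y) -> u1 x y = u2 x y.
Proof.
intros x y Cxy; apply Rle_antisym; apply dirichlet_solution_le; assumption.
Qed.
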